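(* The generators $\sigma$ and $\tau$ of the Heisenberg group $\mathcal H_8$ act on the sets of linear subspaces $\{Q_k\}_{k=0}^7$ (for $I_B$) and $\{R_k\}_{k=0}^7$ (for $I_C$), where $Q_k=\{z_k=0\}$ and $R_k=\{u_k=0\}$ in $\mathbb P^7$, as the following permutations (cycle notation): $$\begin{aligned}&\sigma:(Q_0Q_5Q_4Q_1)(Q_2Q_7Q_6Q_3),&&\tau:(Q_0Q_2Q_4Q_6)(Q_1Q_3Q_5Q_7),\\&\sigma:(R_0R_7R_6R_5R_4R_3R_2R_1),&&\tau:(R_0R_2R_4R_6)(R_1R_3R_5R_7).\end{aligned}$$
   Context: Let $\xi=e^{2\pi i/8}$ and $i=\sqrt{-1}$. $\mathcal H_8=\langle\sigma,\tau\rangle$ acts on the homogeneous coordinates of $\mathbb P^7$ by $\sigma(x_j)=x_{j-1}$ (indices mod 8), $\tau(x_j)=\xi^{-j}x_j$. This extends linearly to linear forms, and $g\in\{\sigma,\tau\}$ sends the hyperplane $\{\ell=0\}$ to $\{g(\ell)=0\}$; e.g. on $P_k=\{x_k=0\}$ this gives $\sigma:(P_0P_7P_6P_5P_4P_3P_2P_1)$ and $\tau$ the identity. The forms $z_k$: $z_0=x_0+x_2-x_4-x_6$, $z_1=x_1+x_3-x_5-x_7$, $z_2=x_0-ix_2+x_4-ix_6$, $z_3=x_1-ix_3+x_5-ix_7$, $z_4=x_0-x_2-x_4+x_6$, $z_5=x_1-x_3-x_5+x_7$, $z_6=x_0+ix_2+x_4+ix_6$, $z_7=x_1+ix_3+x_5+ix_7$.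 The forms $u_k$: $u_0=x_0+\xi x_2-x_4+\xi x_6$, $u_1=x_1+\xi x_3-x_5+\xi x_7$, $u_2=\xi x_0+x_2+\xi x_4-x_6$, $u_3=\xi x_1+x_3+\xi x_5-x_7$, $u_4=-x_0+\xi x_2+x_4+\xi x_6$, $u_5=-x_1+\xi x_3+x_5+\xi x_7$, $u_6=\xi x_0-x_2+\xi x_4+x_6$, $u_7=\xi x_1-x_3+\xi x_5+x_7$. (In the coordinates $z$, resp. $u$, the ideals $I_B=\langle x_0^2+x_4^2+2x_2x_6, x_1^2+x_5^2+2x_3x_7,x_2^2+x_6^2+2x_0x_4,x_3^2+x_7^2+2x_1x_5\rangle$, resp. $I_C=\langle \frac i2(x_0^2+x_4^2)+x_2x_6,\frac i2(x_1^2+x_5^2)+x_3x_7,\frac i2(x_2^2+x_6^2)+x_0x_4,\frac i2(x_3^2+x_7^2)+x_1x_5\rangle$, are generated by the monomials $z_kz_{k+4}$, resp. $u_ku_{k+4}$, $k=0,\dots,3$.) *)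

(* Defs.v *)
From HB Require Import structures.
From mathcomp Require Import all_boot all_order all_algebra.
From mathcomp Require Import boolp classical_sets reals trigo.
From mathcomp Require Import complex.

Set Implicit Arguments.
Unset Strict Implicit.
Unset Printing Implicit Defensive.

Import Order.TTheory GRing.Theory Num.Theory.

Local Open Scope classical_set_scope.
Local Open Scope complex_scope.
Local Open Scope ring_scope.

Lemma lfun_ker_proportional (F : fieldType) (V : vectType F)
    (l m : 'Hom(V, F^o)) :
  l != 0 -> (forall v, l v = 0 -> m v = 0) -> exists a : F, m = a *: l.
Proof.
move=> l0 ker.
have [w lw] : exists w, l w != 0.
  apply: contrapT => /forallNP h; case/eqP: l0; apply/lfunP => v.
  by rewrite zero_lfunE; apply/eqP; apply: contrapT => /negP /h.
exists ((m w : F) / (l w : F)); apply/lfunP => v; rewrite lfunE /=.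
have /ker : l (v - ((l v : F) / (l w : F)) *: w) = 0.
  rewrite linearB linearZ /=; apply/eqP; rewrite subr_eq0; apply/eqP.
  by rewrite -[RHS]/((l v : F) / (l w : F) * (l w : F)) divfK.
rewrite linearB linearZ /= => /eqP; rewrite subr_eq0 => /eqP ->.
rewrite -[LHS]/((l v : F) / (l w : F) * (m w : F)).
rewrite -[RHS]/((m w : F) / (l w : F) * (l v : F)).
by rewrite mulrAC [RHS]mulrAC [(m w : F) * _]mulrC.
Qed.

Lemma lker_scale (F : fieldType) (V W : vectType F) (a : F) (l : 'Hom(V, W)) :
  a != 0 -> lker (a *: l) = lker l.
Proof.
move=> a0; apply/vspaceP => v.
by rewrite !memv_ker lfunE /= scaler_eq0 (negPf a0).
Qed.

Section ProjectiveSpace.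
Variable R : realType.

Definition xi : R[i] := cos (2 * pi / 8) +i* sin (2 * pi / 8).

Definition V8 : vectType R[i] := 'rV[R[i]]_8.

(* Linear forms on C^8. *)
Definition form : vectType R[i] := 'Hom(V8, R[i]^o).

(* The points of P^7 are the lines through the origin of C^8. *)
Definition P7 : Type := {L : {vspace V8} | \dim L == 1%N}.

(* The locus {l = 0} in P^7. *)
Definition zero_locus (l : form) : set P7 :=
  [set p | (sval p <= lker l)%VS].

(* Homogeneous coordinates. Indices live in 'I_8, whose ring structure is
   that of Z/8, so that index arithmetic is modulo 8. *)
Definition x (j : 'I_8) : form := linfun (fun v : 'rV[R[i]]_8 => v 0 j : R[i]^o).

(* The linear map on forms with x_j |-> y_j: a form l is the sum of the
   l(e_j) x_j, where e_j is the standard basis of C^8. *)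
Definition extend_linearly (y : 'I_8 -> form) : 'End(form) :=
  linfun (fun l : form => \sum_j (l (delta_mx 0 j) : R[i]) *: y j).

Definition sigma : 'End(form) := extend_linearly (fun j => x (j - 1)).

Definition tau : 'End(form) :=
  extend_linearly (fun j => xi ^- (j : nat) *: x j).

(* g sends {l = 0} to {g(l) = 0}. A hyperplane determines its equation l only
   up to a nonzero scalar; the definition ranges over all its equations, and
   [hyperplane_actE] shows that the result does not depend on the choice. *)
Definition hyperplane_act (g : 'End(form)) (H : set P7) : set P7 :=
  [set p | exists l : form, [/\ l != 0, H = zero_locus l & zero_locus (g l) p]].

Definition z (k : 'I_8) : form :=
  nth 0 [:: x 0 + x 2 - x 4 - x 6;
            x 1 + x 3 - x 5 - x 7;
            x 0 - 'i%C *: x 2 + x 4 - 'i%C *: x 6;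
            x 1 - 'i%C *: x 3 + x 5 - 'i%C *: x 7;
            x 0 - x 2 - x 4 + x 6;
            x 1 - x 3 - x 5 + x 7;
            x 0 + 'i%C *: x 2 + x 4 + 'i%C *: x 6;
            x 1 + 'i%C *: x 3 + x 5 + 'i%C *: x 7] k.

Definition u (k : 'I_8) : form :=
  nth 0 [:: x 0 + xi *: x 2 - x 4 + xi *: x 6;
            x 1 + xi *: x 3 - x 5 + xi *: x 7;
            xi *: x 0 + x 2 + xi *: x 4 - x 6;
            xi *: x 1 + x 3 + xi *: x 5 - x 7;
            - x 0 + xi *: x 2 + x 4 + xi *: x 6;
            - x 1 + xi *: x 3 + x 5 + xi *: x 7;
            xi *: x 0 - x 2 + xi *: x 4 + x 6;
            xi *: x 1 - x 3 + xi *: x 5 + x 7] k.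

Definition Q (k : 'I_8) : set P7 := zero_locus (z k).
Definition Rk (k : 'I_8) : set P7 := zero_locus (u k).

Lemma xE (j : 'I_8) (v : V8) : x j v = (v : 'rV_8) 0 j.
Proof.
have lf : linear (fun v : 'rV[R[i]]_8 => v 0 j : R[i]^o).
  by move=> a v1 v2; rewrite !mxE.
pose f := GRing.isLinear.Build _ _ _ _ _ lf.
pose g : {linear 'rV[R[i]]_8 -> R[i]^o} := HB.pack (fun v : 'rV[R[i]]_8 => v 0 j : R[i]^o) f.
exact: (lfunE g v).
Qed.

Lemma extend_linearlyE (y : 'I_8 -> form) (l : form) :
  extend_linearly y l = \sum_j (l (delta_mx 0 j) : R[i]) *: y j.
Proof.
have lf : linear (fun l : form => \sum_j (l (delta_mx 0 j) : R[i]) *: y j).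
  move=> a l1 l2; rewrite scaler_sumr -big_split /=; apply: eq_bigr => j _.
  by rewrite lfunE /= lfunE /= scalerA -scalerDl.
pose f := GRing.isLinear.Build _ _ _ _ _ lf.
pose g : {linear form -> form} := HB.pack (fun l : form => \sum_j (l (delta_mx 0 j) : R[i]) *: y j) f.
exact: (lfunE g l).
Qed.

Lemma extend_linearly_x (y : 'I_8 -> form) (k : 'I_8) :
  extend_linearly y (x k) = y k.
Proof.
rewrite extend_linearlyE (bigD1 k) //= xE mxE !eqxx scale1r big1 ?addr0 // => j nk.
by rewrite xE mxE eq_sym (negPf nk) andbF scale0r.
Qed.

Lemma sigma_x (j : 'I_8) : sigma (x j) = x (j - 1).
Proof. exact: extend_linearly_x. Qed.

Lemma tau_x (j : 'I_8) : tau (x j) = xi ^- (j : nat) *: x j.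
Proof. exact: extend_linearly_x. Qed.

Lemma zero_locus_scale (a : R[i]) (l : form) :
  a != 0 -> zero_locus (a *: l) = zero_locus l.
Proof.
by move=> a0; rewrite /zero_locus lker_scale.
Qed.

Lemma zero_locus_inj (l m : form) :
  l != 0 -> zero_locus l = zero_locus m -> exists a : R[i], m = a *: l.
Proof.
move=> l0 lm; apply: (lfun_ker_proportional l0) => v lv.
have [->|v0] := eqVneq v 0; first by rewrite linear0.
have d : \dim <[v]> == 1%N by rewrite dim_vline v0.
pose p : P7 := exist (fun L : {vspace V8} => \dim L == 1%N) <[v]>%VS d.
have : zero_locus l p by rewrite /zero_locus /= -memvE memv_ker lv.
by rewrite lm /zero_locus /= -memvE memv_ker => /eqP.
Qed.

Lemma hyperplane_actE (g : 'End(form)) (l : form) :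
  l != 0 -> hyperplane_act g (zero_locus l) = zero_locus (g l).
Proof.
move=> l0; apply/seteqP; split=> [p /= [m [m0 lm pm]]|p pl /=]; last by exists l.
have [a ma] := zero_locus_inj l0 lm.
have a0 : a != 0 by apply: contraNneq m0 => a0; rewrite ma a0 scale0r.
by move: pm; rewrite ma linearZ zero_locus_scale.
Qed.

End ProjectiveSpace.

(* f restricts to a permutation of S, whose decomposition into disjoint cycles
   is cs: [:: a1; ..; an] in cs means a1 |-> a2 |-> .. |-> an |-> a1. *)
Definition permutes_with_cycles (T : choiceType) (f : T -> T) (S : set T)
    (cs : seq (seq T)) : Prop :=
  [/\ S = [set a | a \in flatten cs], uniq (flatten cs) & all (fcycle f) cs].

(* Main.v *)
Require Import Defs.
From mathcomp Require Import all_boot all_order all_algebra.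
From mathcomp Require Import boolp classical_sets reals trigo.
From mathcomp Require Import complex ring.

Set Implicit Arguments.
Unset Strict Implicit.
Unset Printing Implicit Defensive.

Import Order.TTheory GRing.Theory Num.Theory.

Local Open Scope classical_set_scope.
Local Open Scope ring_scope.

(** Each z_k and each u_k involves only the coordinates of one parity: up to
    reindexing it is a quadruple of coefficients, on x_0, x_2, x_4, x_6 for even
    k and on x_1, x_3, x_5, x_7 for odd k, and z_2m and z_2m+1 (or u_2m and
    u_2m+1) share the same quadruple. On quadruples the generators become simple:
    sigma moves the odd coordinates to the even ones without changing the
    quadruple, and the even ones to the odd ones with a cyclic rotation of it
    (because x_0 goes to x_7); tau multiplies the quadruple entrywise by
    (1, -i, -1, i), up to the global factor xi^-1 for odd coordinates. In both
    lists of four quadruples, rotation and twist send every member to a scalar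
    multiple of another one, as direct inspection shows ([sigma_z_quads],
    [tau_z_quads], [sigma_u_quads], [tau_u_quads]). Scalars do not change
    hyperplanes, so the hyperplanes are mapped as the indices are
    ([hyperplane_act_quads_form]).

    There remains to see that the eight hyperplanes of a family are distinct, so
    that the cycles on indices are really cycles on hyperplanes. The four
    quadruples are pairwise orthogonal for the standard Hermitian product
    ([orthogonal_z_quads], [orthogonal_u_quads]), and forms of different parity
    have disjoint supports; hence the eight forms are pairwise orthogonal, and
    orthogonal nonzero forms are not proportional ([zero_locus_neq]). *)

(** * Cycles of an indexed family *)

(** Cycles computed on indices transfer along an injective equivariant
    indexing, so that decidable computation on 'I_8 settles the combinatorics
    of a permutation of sets. *)
Lemma permutes_with_cycles_map (T : choiceType) (I : finType) (F : I -> T)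
    (f : T -> T) (g : I -> I) (cs : seq (seq I)) :
    injective F -> (forall k, f (F k) = F (g k)) ->
    uniq (flatten cs) -> (forall k, k \in flatten cs) -> all (fcycle g) cs ->
  permutes_with_cycles f (range F) (map (map F) cs).
Proof.
move=> Finj fF csU csT gcs; split; rewrite -?map_flatten ?map_inj_uniq //.
- apply/seteqP; split=> [_ [k _ <-]|a /mapP[k _ ->]] /=; last by exists k.
  exact: map_f.
- rewrite all_map; apply: sub_all gcs => c /=.
  have -> : fcycle f (map F c) = cycle (relpre F (frel f)) c.
    by case: c => //= a c; rewrite -map_rcons path_map.
  by have /eq_cycle-> : relpre F (frel f) =2 frel g by move=> a b /=; rewrite fF inj_eq.
Qed.

(** Case analysis yielding the ring numerals 0, .., 7 rather than explicit
    ordinals, so that the cases match the indices of the coordinates. *)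
Lemma ord8_ind (P : 'I_8 -> Prop) :
  P 0 -> P 1 -> P 2 -> P 3 -> P 4 -> P 5 -> P 6 -> P 7 -> forall k, P k.
Proof.
move=> P0 P1 P2 P3 P4 P5 P6 P7 [k lt_k8].
do 8![case: k lt_k8 => [|k] lt_k8;
  first by match goal with H : P ?j |- _ =>
    rewrite (_ : Ordinal lt_k8 = j) //; exact: val_inj end].
by [].
Qed.

(** * The eighth root of unity *)

Section Forms.
Variable R : realType.

Local Notation C := R[i].
Local Notation xi := (xi R).
Local Notation form := (Defs.form R).
Local Notation x := (@x R).

Lemma xi_sqr : xi ^+ 2 = 'i%C.
Proof.
have pi4 : 2 * pi / 8 + 2 * pi / 8 = pi / 2 :> R by field.
rewrite expr2 /Defs.xi; apply/eqP; rewrite eq_complex /=; apply/andP; split; apply/eqP.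
  by rewrite -cosD pi4 cos_pihalf.
by rewrite addrC -sinD pi4 sin_pihalf.
Qed.

Lemma xi_pow4 : xi ^+ 4 = -1.
Proof. by rewrite (exprM _ 2 2) xi_sqr sqr_i. Qed.

Lemma xi_neq0 : xi != 0.
Proof.
by apply/eqP => h; move: xi_pow4; rewrite h expr0n /= => /eqP; rewrite eq_sym oppr_eq0 oner_eq0.
Qed.

Lemma i_neq0 : 'i%C != 0 :> C.
Proof. by rewrite -xi_sqr expf_neq0 // xi_neq0. Qed.

Lemma xi_mul_conj : xi * xi^*%C = 1.
Proof.
rewrite /Defs.xi; apply/eqP; rewrite eq_complex /=; apply/andP; split; apply/eqP.
  by rewrite mulrN opprK -!expr2 cos2Dsin2.
by rewrite mulrN mulrC addNr.
Qed.

(** * Forms supported on the coordinates of one parity *)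

(** The base index p is arbitrary, rather than 0 or 1, so that sigma merely shifts
    it; the sums are modulo 8. *)
Definition parity_form (p : 'I_8) (a b c d : C) : form :=
  a *: x p + b *: x (p + 2) + c *: x (p + 4) + d *: x (p + 6).

Lemma parity_form0 a b c d :
  parity_form 0 a b c d = a *: x 0 + b *: x 2 + c *: x 4 + d *: x 6.
Proof. by rewrite /parity_form !add0r. Qed.

Lemma parity_form1 a b c d :
  parity_form 1 a b c d = a *: x 1 + b *: x 3 + c *: x 5 + d *: x 7.
Proof.
rewrite /parity_form (_ : 1 + 2 = 3 :> 'I_8) 1?(_ : 1 + 4 = 5 :> 'I_8)
  1?(_ : 1 + 6 = 7 :> 'I_8) //; exact: val_inj.
Qed.

Lemma parity_form_eq p a b c d a' b' c' d' : a = a' -> b = b' -> c = c' -> d = d' ->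
  parity_form p a b c d = parity_form p a' b' c' d'.
Proof. by move=> -> -> -> ->. Qed.

Lemma parity_formZ s p a b c d :
  s *: parity_form p a b c d = parity_form p (s * a) (s * b) (s * c) (s * d).
Proof. by rewrite /parity_form !scalerDr !scalerA. Qed.

Lemma linear_parity_form (g : 'End(form)) p a b c d : g (parity_form p a b c d) =
  a *: g (x p) + b *: g (x (p + 2)) + c *: g (x (p + 4)) + d *: g (x (p + 6)).
Proof.
have gD l m : g (l + m) = g l + g m by exact: linearD.
have gZ k l : g (k *: l) = k *: g l by exact: linearZ.
by rewrite /parity_form !gD !gZ.
Qed.

Lemma sigma_parity_form p a b c d : sigma R (parity_form p a b c d) = parity_form (p - 1) a b c d.
Proof. by rewrite linear_parity_form !sigma_x !(addrAC p _ (-1)). Qed.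

(** Shifting the base index by 2 comes back to p after four steps, since indices
    are modulo 8. *)
Lemma parity_form_rot p a b c d : parity_form p a b c d = parity_form (p + 2) b c d a.
Proof.
have p8 : p + 2 + 6 = p by rewrite -addrA (_ : 2 + 6 = 0) ?addr0 //; exact: val_inj.
rewrite /parity_form p8 -!(addrA p) (_ : 2 + 2 = 4 :> 'I_8) 1?(_ : 2 + 4 = 6 :> 'I_8); try exact: val_inj.
by rewrite -!addrA addrC !addrA.
Qed.

(** For even coordinates the base index becomes -1 = 7; rebasing it at 1 is what
    rotates the quadruple. *)
Lemma sigma_parity_form_bool (e : bool) a b c d :
  sigma R (parity_form e%:R a b c d) = if e then parity_form 0 a b c d else parity_form 1 b c d a.
Proof.
rewrite sigma_parity_form; case: e; first by rewrite subrr.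
by rewrite parity_form_rot (_ : 0 - 1 + 2 = 1 :> 'I_8) //; exact: val_inj.
Qed.

(** The factors xi^-2, xi^-4, xi^-6 are -i, -1, i. *)
Lemma tau_parity_form p a b c d :
  tau R (parity_form p a b c d) = xi ^- p *: parity_form p a (- ('i%C * b)) (- c) ('i%C * d).
Proof.
(* The exponent p + r is reduced modulo 8, which is harmless as xi^8 = 1. *)
have xi8 : xi ^+ 8 = 1 by rewrite (exprM _ 4 2) xi_pow4 sqrrN expr1n.
have xiD (r : 'I_8) : xi ^- (p + r)%R = xi ^- p * xi ^- r.
  by rewrite -invfM -exprD -(expr_mod (p + r)%N xi8).
rewrite linear_parity_form !tau_x (xiD 2) (xiD 4) (xiD 6) /parity_form !scalerDr !scalerA.
have xi2 : xi ^- 2 = - xi ^+ 2.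
  by rewrite -(mulr1 (xi ^- 2)) -[1]opprK -xi_pow4 (exprD _ 2 2) mulrN mulKf ?expf_neq0 // xi_neq0.
have xi6 : xi ^- 6 = xi ^+ 2.
  by rewrite (exprD _ 4 2) invfM xi_pow4 invrN1 xi2 mulrNN mul1r.
rewrite [nat_of_ord 2]/= [nat_of_ord 4]/= [nat_of_ord 6]/= xi2 xi_pow4 invrN1 xi6.
rewrite xi_sqr; set s := xi ^- p; set w := 'i%C.
have -> : a * s = s * a by ring.
have -> : b * (s * - w) = s * - (w * b) by ring.
have -> : c * (s * -1) = s * - c by ring.
by have -> : d * (s * w) = s * (w * d) by ring.
Qed.

(** * Orthogonality of forms *)

Definition entry (l : form) (j : 'I_8) : C := l (delta_mx 0 j).

Lemma entryZ k l j : entry (k *: l) j = k * entry l j.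
Proof. by rewrite /entry scale_lfunE. Qed.

Definition dot (l m : form) : C := \sum_j entry l j * (entry m j)^*%C.

(** If the loci agreed then m would be a * l, and 0 = dot l m = conj a * dot l l
    would force a = 0. *)
Lemma zero_locus_neq (l m : form) :
  dot l l != 0 -> dot m m != 0 -> dot l m = 0 -> zero_locus l <> zero_locus m.
Proof.
move=> ll mm lm E.
have dotZ k k' l1 l2 : dot (k *: l1) (k' *: l2) = k * k'^*%C * dot l1 l2.
  rewrite /dot mulr_sumr; apply: eq_bigr => j _.
  by rewrite !entryZ rmorphM mulrACA.
have l0 : l != 0 by apply: contraNneq ll => ->; rewrite -(scale0r 0) dotZ !mul0r.
have [a ma] := zero_locus_inj l0 E.
move: lm mm; rewrite {}ma -{1}[l]scale1r !dotZ mul1r => /eqP.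
by rewrite mulf_eq0 (negPf ll) orbF => /eqP ->; rewrite mulr0 mul0r eqxx.
Qed.

Lemma entry_parity_form p a b c d j : entry (parity_form p a b c d) j =
  a * (p == j)%:R + b * (p + 2 == j)%:R + c * (p + 4 == j)%:R + d * (p + 6 == j)%:R.
Proof.
have entryD l m : entry (l + m) j = entry l j + entry m j by rewrite /entry add_lfunE.
have entryx i : entry (x i) j = (i == j)%:R by rewrite /entry xE mxE.
by rewrite /parity_form !entryD !entryZ !entryx.
Qed.

Lemma dot_parity_form (p q : bool) a b c d a' b' c' d' :
  dot (parity_form p%:R a b c d) (parity_form q%:R a' b' c' d') =
  (a * a'^*%C + b * b'^*%C + c * c'^*%C + d * d'^*%C) * (p == q)%:R.
Proof.
rewrite /dot !big_ord_recl big_ord0 !entry_parity_form.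
case: p q => [] [] /=; rewrite ?(mulr0, mulr1, addr0, add0r, mul0r, rmorph0) //; ring.
Qed.

(** * The two families *)

(** The form of index k = 2m + e has the quadruple q m, placed on the coordinates
    of parity e. *)
Definition quads_form (q : nat -> seq C) (k : 'I_8) : form :=
  let r := q k./2 in parity_form (odd k)%:R r`_0 r`_1 r`_2 r`_3.

Definition z_quads : nat -> seq C := nth [::]
  [:: [:: 1; 1; -1; -1]; [:: 1; - 'i%C; 1; - 'i%C];
      [:: 1; -1; -1; 1]; [:: 1; 'i%C; 1; 'i%C]].

Definition u_quads : nat -> seq C := nth [::]
  [:: [:: 1; xi; -1; xi]; [:: xi; 1; xi; -1];
      [:: -1; xi; 1; xi]; [:: xi; -1; xi; 1]].

Lemma z_quads_form k : @Defs.z R k = quads_form z_quads k.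
Proof.
by elim/ord8_ind: k; rewrite /Defs.z /quads_form /= ?parity_form0 ?parity_form1 ?scaleNr ?scale1r.
Qed.

Lemma u_quads_form k : @Defs.u R k = quads_form u_quads k.
Proof.
by elim/ord8_ind: k; rewrite /Defs.u /quads_form /= ?parity_form0 ?parity_form1 ?scaleNr ?scale1r.
Qed.

Definition orthogonal_quads (q : nat -> seq C) : Prop := forall m n, (m < 4)%N -> (n < 4)%N ->
  (q m)`_0 * ((q n)`_0)^*%C + (q m)`_1 * ((q n)`_1)^*%C
    + (q m)`_2 * ((q n)`_2)^*%C + (q m)`_3 * ((q n)`_3)^*%C = 4 * (m == n)%:R.

Lemma conjcN (a : C) : (- a)^*%C = - a^*%C. Proof. exact: rmorphN. Qed.

Lemma orthogonal_z_quads : orthogonal_quads z_quads.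
Proof.
have ii : 'i%C * ('i%C)^*%C = 1 :> C
  by apply/eqP; rewrite eq_complex /=; apply/andP; split; apply/eqP; ring.
rewrite /orthogonal_quads.
(* Only conj (- a) = - conj a, conj 1 = 1 and i * conj i = 1 matter; with conj abstract,
   simplification cannot unfold it into real and imaginary parts. *)
move: conjcN (@conjc1 R) ii; move: (@conjc R) => conj conjN conj1 ii.
by case=> [|[|[|[|//]]]] [|[|[|[|//]]]] _ _ /=; rewrite ?conjN ?conj1; ring: ii.
Qed.

Lemma orthogonal_u_quads : orthogonal_quads u_quads.
Proof.
rewrite /orthogonal_quads.
move: conjcN (@conjc1 R) xi_mul_conj; move: (@conjc R) => conj conjN conj1 xx.
by case=> [|[|[|[|//]]]] [|[|[|[|//]]]] _ _ /=; rewrite ?conjN ?conj1; ring: xx.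
Qed.

(** * Action on a family with orthogonal quadruples *)

Section OrthogonalFamily.
Variable q : nat -> seq C.
Hypothesis q_orth : orthogonal_quads q.

Lemma dot_quads_form j k : dot (quads_form q j) (quads_form q k) = 4 * (j == k)%:R.
Proof.
have lt4 (i : 'I_8) : (i./2 < 4)%N by rewrite ltn_half_double.
rewrite /quads_form dot_parity_form q_orth // -mulrA -natrM mulnb; congr (_ * _%:R).
congr nat_of_bool; apply/andP/eqP => [[/eqP hj /eqP oj]|-> //].
by apply: val_inj; rewrite /= -(odd_double_half j) -(odd_double_half k) hj oj.
Qed.

Lemma dot_quads_form_neq0 k : dot (quads_form q k) (quads_form q k) != 0.
Proof. by rewrite dot_quads_form eqxx mulr1 pnatr_eq0. Qed.

Lemma zero_locus_quads_form_inj : injective (fun k => zero_locus (quads_form q k)).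
Proof.
move=> j k E; apply: contrapT => /eqP jk.
apply: (zero_locus_neq _ _ _ E); try exact: dot_quads_form_neq0.
by rewrite dot_quads_form (negPf jk) mulr0.
Qed.

Lemma hyperplane_act_quads_form (g : 'End(form)) (pi : 'I_8 -> 'I_8) k :
    (exists2 s, s != 0 & g (quads_form q k) = s *: quads_form q (pi k)) ->
  hyperplane_act g (zero_locus (quads_form q k)) = zero_locus (quads_form q (pi k)).
Proof.
move=> [s s0 gk]; rewrite hyperplane_actE ?gk ?zero_locus_scale //.
apply: contraNneq (dot_quads_form_neq0 k) => ->; rewrite /dot big1 // => j _.
by rewrite -(scale0r 0) entryZ !mul0r.
Qed.

Lemma permutes_quads_form (g : 'End(form)) (pi : 'I_8 -> 'I_8) (cs : seq (seq 'I_8)) :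
    (forall k, exists2 s, s != 0 & g (quads_form q k) = s *: quads_form q (pi k)) ->
    uniq (flatten cs) -> (forall k, k \in flatten cs) -> all (fcycle pi) cs ->
  permutes_with_cycles (hyperplane_act g) (range (fun k => zero_locus (quads_form q k)))
    (map (map (fun k => zero_locus (quads_form q k))) cs).
Proof.
move=> gq; apply: permutes_with_cycles_map zero_locus_quads_form_inj _.
by move=> k; apply: hyperplane_act_quads_form.
Qed.

End OrthogonalFamily.

(** * The generators on the two families *)

(** For odd k the index simply drops by 1. For even k the index modulo 8 is
    raised by 5: the rotation exchanges the quadruples 0 and 2, and 1 and 3, up
    to sign or a factor i, and the parity changes. *)
Lemma sigma_z_quads (k : 'I_8) :
  let k' := if odd k then k - 1 else k + 5 in
  exists2 s, s != 0 & sigma R (quads_form z_quads k) = s *: quads_form z_quads k'.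
Proof.
exists (if odd k then 1 else [:: 1; - 'i%C; -1; 'i%C]`_(k./2)).
  by elim/ord8_ind: k; rewrite /= ?oppr_eq0 ?oner_eq0 ?i_neq0.
rewrite {1}/quads_form sigma_parity_form_bool.
elim/ord8_ind: k; rewrite /quads_form /= parity_formZ; apply: parity_form_eq; ring: (sqr_i R).
Qed.

(** Each quadruple in the list is exactly the rotation of the cyclically next
    one: no scalar appears, and all eight forms make a single cycle. *)
Lemma sigma_u_quads k :
  exists2 s, s != 0 & sigma R (quads_form u_quads k) = s *: quads_form u_quads (k - 1).
Proof.
exists 1; first exact: oner_neq0.
rewrite scale1r {1}/quads_form sigma_parity_form_bool.
by elim/ord8_ind: k.
Qed.

Lemma tau_z_quads k :
  exists2 s, s != 0 & tau R (quads_form z_quads k) = s *: quads_form z_quads (k + 2).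
Proof.
exists (xi ^- ((odd k)%:R : 'I_8)); first by rewrite invr_neq0 ?expf_neq0 ?xi_neq0.
rewrite {1}/quads_form tau_parity_form; congr (_ *: _).
elim/ord8_ind: k; rewrite /quads_form /=; apply: parity_form_eq; ring: (sqr_i R).
Qed.

Lemma tau_u_quads k :
  exists2 s, s != 0 & tau R (quads_form u_quads k) = s *: quads_form u_quads (k + 2).
Proof.
(* xi^-1 from the odd coordinates, times the factor read off from the first
   entries: (q m)_0 / (q (m+1 mod 4))_0, with 1 / xi written - xi^3. *)
exists (xi ^- ((odd k)%:R : 'I_8) * [:: - xi ^+ 3; - xi; xi ^+ 3; xi]`_(k./2)).
  rewrite mulf_neq0 ?invr_neq0 ?expf_neq0 ?xi_neq0 //.
  by elim/ord8_ind: k; rewrite /= ?oppr_eq0 ?expf_neq0 ?xi_neq0.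
rewrite {1}/quads_form tau_parity_form -scalerA -xi_sqr; congr (_ *: _).
elim/ord8_ind: k; rewrite /quads_form /= parity_formZ; apply: parity_form_eq; ring: xi_pow4.
Qed.

End Forms.

Theorem proposition8p9 (R : realType) :
  let Q := @Q R in
  let Rk := @Rk R in
  [/\ permutes_with_cycles (hyperplane_act (sigma R)) (range Q)
        [:: [:: Q 0; Q 5; Q 4; Q 1]; [:: Q 2; Q 7; Q 6; Q 3]],
      permutes_with_cycles (hyperplane_act (tau R)) (range Q)
        [:: [:: Q 0; Q 2; Q 4; Q 6]; [:: Q 1; Q 3; Q 5; Q 7]],
      permutes_with_cycles (hyperplane_act (sigma R)) (range Rk)
        [:: [:: Rk 0; Rk 7; Rk 6; Rk 5; Rk 4; Rk 3; Rk 2; Rk 1]] &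
      permutes_with_cycles (hyperplane_act (tau R)) (range Rk)
        [:: [:: Rk 0; Rk 2; Rk 4; Rk 6]; [:: Rk 1; Rk 3; Rk 5; Rk 7]]].
Proof.
move=> Q Rk.
have -> : Q = fun k => zero_locus (quads_form (z_quads R) k).
  by apply/funext => k; rewrite -z_quads_form.
have -> : Rk = fun k => zero_locus (quads_form (u_quads R) k).
  by apply/funext => k; rewrite -u_quads_form.
split.
- apply: (permutes_quads_form (@orthogonal_z_quads R)
    (cs := [:: [:: 0; 5; 4; 1]; [:: 2; 7; 6; 3]]) (@sigma_z_quads R)) => //.
  by elim/ord8_ind.
- apply: (permutes_quads_form (@orthogonal_z_quads R)
    (cs := [:: [:: 0; 2; 4; 6]; [:: 1; 3; 5; 7]]) (@tau_z_quads R)) => //.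
  by elim/ord8_ind.
- apply: (permutes_quads_form (@orthogonal_u_quads R)
    (cs := [:: [:: 0; 7; 6; 5; 4; 3; 2; 1]]) (@sigma_u_quads R)) => //.
  by elim/ord8_ind.
- apply: (permutes_quads_form (@orthogonal_u_quads R)
    (cs := [:: [:: 0; 2; 4; 6]; [:: 1; 3; 5; 7]]) (@tau_u_quads R)) => //.
  by elim/ord8_ind.
Qed.
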